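(* Let $\mathcal{L}$ be a finite lattice and let $\mathcal{D}$ be a triangulated category with a right (respectively left) admissible $\mathcal{L}$-filtration $I\mapsto\mathcal{D}_I$. Then the map $\mathcal{L}^{\mathrm{op}}\to\mathrm{lAdm}(\mathcal{D})$, $I\mapsto\mathcal{D}_I^\perp$ (respectively $\mathcal{L}^{\mathrm{op}}\to\mathrm{rAdm}(\mathcal{D})$, $I\mapsto{}^\perp\mathcal{D}_I$) defines a left (respectively right) admissible $\mathcal{L}^{\mathrm{op}}$-filtration on $\mathcal{D}$, which is strict if the original filtration is strict.
   Context: Subcategories of triangulated categories are full triangulated, closed under isomorphism. A subcategory $\mathcal{D}_0\subset\mathcal{D}$ is left (right) admissible if its inclusion has a left (right) adjoint. Put $\mathcal{D}_0^\perp=\{D:\mathrm{Hom}(\mathcal{D}_0,D)=0\}$ and ${}^\perp\mathcal{D}_0=\{D:\mathrm{Hom}(D,\mathcal{D}_0)=0\}$. $\mathrm{lAdm}(\mathcal{D})$, $\mathrm{rAdm}(\mathcal{D})$ are the posets (by inclusion) of left, respectively right, admissible subcategories. Let $\mathcal{L}$ be a finite lattice with order $\preceq$, meet $\cap$, join $\cup$, minimum $0$, maximum $1$; $\mathcal{L}^{\mathrm{op}}$ is the lattice with the opposite order. A right admissible $\mathcal{L}$-filtration on $\mathcal{D}$ is an order-preserving map $\mathcal{L}\to\mathrm{rAdm}(\mathcal{D})$, $I\mapsto\mathcal{D}_I$, with $\mathcal{D}_0=0$, $\mathcal{D}_1=\mathcal{D}$, and for all $I,J$: $\mathcal{D}_{I\cap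 J}=\mathcal{D}_I\cap\mathcal{D}_J$ and $\mathcal{D}_{I\cup J}^\perp=\mathcal{D}_I^\perp\cap\mathcal{D}_J^\perp$. A left admissible $\mathcal{L}$-filtration is an order-preserving map $\mathcal{L}\to\mathrm{lAdm}(\mathcal{D})$ with $\mathcal{D}_0=0$, $\mathcal{D}_1=\mathcal{D}$, $\mathcal{D}_{I\cap J}=\mathcal{D}_I\cap\mathcal{D}_J$ and ${}^\perp\mathcal{D}_{I\cup J}={}^\perp\mathcal{D}_I\cap{}^\perp\mathcal{D}_J$. A left or right admissible filtration is strict if for all $I,J\in\mathcal{L}$, $\mathrm{Hom}(\mathcal{D}_I/\mathcal{D}_{I\cap J},\mathcal{D}_J/\mathcal{D}_{I\cap J})=0$ in the Verdier quotient $\mathcal{D}_{I\cup J}/\mathcal{D}_{I\cap J}$. *)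

(* Defs.v *)
From HB Require Import structures.
From mathcomp Require Import all_boot all_order all_algebra.
From mathcomp Require Import boolp classical_sets.

Set Implicit Arguments.
Unset Strict Implicit.
Unset Printing Implicit Defensive.

Import Order.TTheory GRing.Theory.
Local Open Scope classical_set_scope.
Local Open Scope ring_scope.

(* Hom-groups are [zmodType]s, hence equality of morphisms is Leibniz equality;
   the eqType and choiceType structures they carry exist on any type under the
   classical axioms of [boolp]. *)
Record preadditive := Preadditive {
  obj :> Type;
  hom : obj -> obj -> zmodType;
  id_ : forall X, hom X X;
  comp : forall X Y Z, hom Y Z -> hom X Y -> hom X Z;
  compA : forall X Y Z W (h : hom Z W) (g : hom Y Z) (f : hom X Y),
    comp h (comp g f) = comp (comp h g) f;
  comp1l : forall X Y (f : hom X Y), comp (id_ Y) f = f;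
  comp1r : forall X Y (f : hom X Y), comp f (id_ X) = f;
  compDl : forall X Y Z (g g' : hom Y Z) (f : hom X Y),
    comp (g + g') f = comp g f + comp g' f;
  compDr : forall X Y Z (g : hom Y Z) (f f' : hom X Y),
    comp g (f + f') = comp g f + comp g f' }.

Arguments hom {p} X Y.
Arguments id_ {p} X.
Arguments comp {p X Y Z} g f.
Notation "g \oc f" := (comp g f) (at level 45, right associativity).

Definition is_iso (C : preadditive) (X Y : C) (f : hom X Y) : Prop :=
  exists g : hom Y X, g \oc f = id_ X /\ f \oc g = id_ Y.

Definition is_zero (C : preadditive) (X : C) : Prop :=
  (forall (Y : C) (f : hom X Y), f = 0) /\ (forall (Y : C) (f : hom Y X), f = 0).

Definition is_biproduct (C : preadditive) (X Y B : C)
    (i : hom X B) (j : hom Y B) (p : hom B X) (q : hom B Y) : Prop :=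
  [/\ p \oc i = id_ X, q \oc j = id_ Y, p \oc j = 0, q \oc i = 0
    & i \oc p + j \oc q = id_ B].

Definition is_additive (C : preadditive) : Prop :=
  (exists Z : C, is_zero Z) /\
  (forall X Y : C, exists (B : C) (i : hom X B) (j : hom Y B)
     (p : hom B X) (q : hom B Y), is_biproduct i j p q).

Record functor (C E : preadditive) := Functor {
  fobj :> C -> E;
  fmap : forall X Y : C, hom X Y -> hom (fobj X) (fobj Y);
  fmap1 : forall X : C, fmap (id_ X) = id_ (fobj X);
  fmapM : forall (X Y Z : C) (g : hom Y Z) (f : hom X Y),
    fmap (g \oc f) = fmap g \oc fmap f }.

Arguments fmap {C E} f {X Y} _ : rename.

Definition is_equivalence (C E : preadditive) (F : functor C E) : Prop :=
  (forall X Y : C, bijective (@fmap C E F X Y)) /\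
  (forall Y : E, exists (X : C) (f : hom (F X) Y), is_iso f).

(* [F] is left adjoint to [G]. *)
Definition adjoint (C E : preadditive) (F : functor C E) (G : functor E C) : Prop :=
  exists phi : forall (X : C) (Y : E), hom (F X) Y -> hom X (G Y),
  [/\ forall X Y, bijective (phi X Y),
      forall (X X' : C) (Y : E) (u : hom X' X) (f : hom (F X) Y),
        phi X' Y (f \oc fmap F u) = phi X Y f \oc u
    & forall (X : C) (Y Y' : E) (v : hom Y Y') (f : hom (F X) Y),
        phi X Y' (v \oc f) = fmap G v \oc phi X Y f].

Definition has_left_adjoint (E C : preadditive) (G : functor E C) : Prop :=
  exists F : functor C E, adjoint F G.

Definition has_right_adjoint (C E : preadditive) (F : functor C E) : Prop :=
  exists G : functor E C, adjoint F G.

Section FullSubcategory.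
Variables (C : preadditive) (P : set C).

Definition full_sub : preadditive :=
  @Preadditive {X : C | P X} (fun X Y => hom (sval X) (sval Y))
    (fun X => id_ (sval X)) (fun X Y Z g f => g \oc f)
    (fun X Y Z W h g f => compA h g f)
    (fun X Y f => comp1l f) (fun X Y f => comp1r f)
    (fun X Y Z g g' f => compDl g g' f) (fun X Y Z g f f' => compDr g f f').

Definition full_incl : functor full_sub C :=
  @Functor full_sub C (fun X => sval X) (fun X Y f => f)
    (fun X => erefl) (fun X Y Z g f => erefl).

End FullSubcategory.

(* The shift is an autoequivalence, not necessarily an automorphism, and the
   octahedral axiom is included.  [dist f g h] means that
   X --f--> Y --g--> Z --h--> shift X is distinguished. *)
Record triangulated := Triangulated {
  tcat :> preadditive;
  tcat_additive : is_additive tcat;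
  shift : functor tcat tcat;
  shiftD : forall (X Y : tcat) (f g : hom X Y),
    fmap shift (f + g) = fmap shift f + fmap shift g;
  shift_equiv : is_equivalence shift;
  dist : forall X Y Z : tcat, hom X Y -> hom Y Z -> hom Z (shift X) -> Prop;
  dist_iso : forall (X Y Z X' Y' Z' : tcat)
      (f : hom X Y) (g : hom Y Z) (h : hom Z (shift X))
      (f' : hom X' Y') (g' : hom Y' Z') (h' : hom Z' (shift X'))
      (a : hom X X') (b : hom Y Y') (c : hom Z Z'),
    is_iso a -> is_iso b -> is_iso c ->
    b \oc f = f' \oc a -> c \oc g = g' \oc b ->
    fmap shift a \oc h = h' \oc c ->
    dist f g h -> dist f' g' h';
  dist_id : forall X Z : tcat, is_zero Z ->
    dist (id_ X) (0 : hom X Z) (0 : hom Z (shift X));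
  dist_cone : forall (X Y : tcat) (f : hom X Y),
    exists (Z : tcat) (g : hom Y Z) (h : hom Z (shift X)), dist f g h;
  dist_rot : forall (X Y Z : tcat)
      (f : hom X Y) (g : hom Y Z) (h : hom Z (shift X)),
    dist f g h <-> dist g h (- fmap shift f);
  dist_fill : forall (X Y Z X' Y' Z' : tcat)
      (f : hom X Y) (g : hom Y Z) (h : hom Z (shift X))
      (f' : hom X' Y') (g' : hom Y' Z') (h' : hom Z' (shift X'))
      (a : hom X X') (b : hom Y Y'),
    dist f g h -> dist f' g' h' -> b \oc f = f' \oc a ->
    exists c : hom Z Z', c \oc g = g' \oc b /\ fmap shift a \oc h = h' \oc c;
  dist_octahedron : forall (X Y Z Z' X' Y' : tcat)
      (f : hom X Y) (f1 : hom Y Z') (f2 : hom Z' (shift X))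
      (g : hom Y Z) (g1 : hom Z X') (g2 : hom X' (shift Y))
      (h1 : hom Z Y') (h2 : hom Y' (shift X)),
    dist f f1 f2 -> dist g g1 g2 -> dist (g \oc f) h1 h2 ->
    exists (u : hom Z' Y') (v : hom Y' X'),
      [/\ dist u v (fmap shift f1 \oc g2),
          u \oc f1 = h1 \oc g, h2 \oc u = f2,
          v \oc h1 = g1 & g2 \oc v = fmap shift f \oc h2] }.

Arguments shift {t}.
Arguments dist {t X Y Z} f g h.

Section Subcategories.
Variable D : triangulated.

(* Full triangulated subcategories closed under isomorphism, given by their
   sets of objects. *)
Definition triangulated_sub (P : set D) : Prop :=
  [/\ forall X : D, is_zero X -> P X,
      forall (X Y : D) (f : hom X Y), is_iso f -> P X -> P Y,
      forall X : D, P (shift X) <-> P X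
    & forall (X Y Z : D) (f : hom X Y) (g : hom Y Z) (h : hom Z (shift X)),
        dist f g h -> P X -> P Y -> P Z].

Definition left_admissible (P : set D) : Prop :=
  triangulated_sub P /\ has_left_adjoint (full_incl P).

Definition right_admissible (P : set D) : Prop :=
  triangulated_sub P /\ has_right_adjoint (full_incl P).

(* [orthr P] is P^perp and [orthl P] is ^perp P. *)
Definition orthr (P : set D) : set D :=
  [set Y | forall X : D, P X -> forall f : hom X Y, f = 0].

Definition orthl (P : set D) : set D :=
  [set X | forall Y : D, P Y -> forall f : hom X Y, f = 0].

(* A morphism X -> Y in the Verdier quotient A / N (for triangulated
   subcategories N `<=` A of D and X, Y in A) is a class of roofs
   X <--s-- Z --f--> Y with Z in A and the cone of s in N.  Two roofs are
   identified when some roof dominates both. *)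
Record span (X Y : D) := Span {
  apex : D;
  denom : hom apex X;
  numer : hom apex Y }.

Definition cone_in (N : set D) (X Y : D) (s : hom X Y) : Prop :=
  exists (Z : D) (g : hom Y Z) (h : hom Z (shift X)), dist s g h /\ N Z.

Definition is_roof (A N : set D) (X Y : D) (r : span X Y) : Prop :=
  A (apex r) /\ cone_in N (denom r).

Definition roof_eq (A N : set D) (X Y : D) (r r' : span X Y) : Prop :=
  exists (W : D) (u : hom W (apex r)) (u' : hom W (apex r')),
    [/\ A W, cone_in N (denom r \oc u),
        denom r \oc u = denom r' \oc u' & numer r \oc u = numer r' \oc u'].

(* The image of f : X -> Y under the quotient functor A -> A / N. *)
Definition roof_of (X Y : D) (f : hom X Y) : span X Y := Span (id_ X) f.

(* Hom(X, Y) = 0 in A / N. *)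
Definition verdier_hom0 (A N : set D) (X Y : D) : Prop :=
  forall r : span X Y, is_roof A N r -> roof_eq A N r (roof_of 0).

End Subcategories.

Section Filtrations.
Variables (d : Order.disp_t) (L : finTBLatticeType d) (D : triangulated).

Definition right_admissible_filtration (F : L -> set D) : Prop :=
  [/\ forall I, right_admissible (F I),
      forall I J, (I <= J)%O -> F I `<=` F J,
      F \bot%O = [set X | is_zero X] /\ F \top%O = setT,
      forall I J, F (Order.meet I J) = F I `&` F J
    & forall I J, orthr (F (Order.join I J)) = orthr (F I) `&` orthr (F J)].

Definition left_admissible_filtration (F : L -> set D) : Prop :=
  [/\ forall I, left_admissible (F I),
      forall I J, (I <= J)%O -> F I `<=` F J,
      F \bot%O = [set X | is_zero X] /\ F \top%O = setT,
      forall I J, F (Order.meet I J) = F I `&` F J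
    & forall I J, orthl (F (Order.join I J)) = orthl (F I) `&` orthl (F J)].

Definition strict_filtration (F : L -> set D) : Prop :=
  forall (I J : L) (X Y : D), F I X -> F J Y ->
    verdier_hom0 (F (Order.join I J)) (F (Order.meet I J)) X Y.

End Filtrations.

(* Main.v *)
(** A right (left) admissible subcategory [P] is one half of a semiorthogonal
    decomposition [D = <P, Q>] with [Q = orthr P] (resp. [P = orthl Q]), and such
    a pair makes [P] right admissible and [Q] left admissible.  Everything but
    strictness is then formal.

    For strictness fix I and J, put M = I meet J and U = I join J, and write
    [PI], [QI], and so on, for the four decompositions.  The quotients
    [PU / PM] and [QM / QU] are both equivalent to [PU `&` QM]; strictness of
    [P] says that Hom vanishes from [PI `&` QM] to [PJ `&` QM] and conversely,
    that of [Q] says the same for [PU `&` QI] and [PU `&` QJ].  Under either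
    condition [PU `&` QI = PJ `&` QM] and [PU `&` QJ = PI `&` QM], so the two are
    equivalent. *)
From mathcomp Require Import all_boot all_order ssralg.
From mathcomp Require Import boolp classical_sets.
Require Import Defs.

Set Implicit Arguments.
Unset Strict Implicit.
Unset Printing Implicit Defensive.

(** * Preadditive categories and adjoints of full inclusions *)

Section Preadditive.
Import GRing.Theory.
Local Open Scope ring_scope.
Local Open Scope classical_set_scope.
Variable C : preadditive.

Lemma comp0l (X Y Z : C) (f : hom X Y) : (0 : hom Y Z) \oc f = 0.
Proof. by apply: (addIr (0 \oc f)); rewrite -compDl !add0r. Qed.

Lemma comp0r (X Y Z : C) (g : hom Y Z) : g \oc (0 : hom X Y) = 0.
Proof. by apply: (addIr (g \oc 0)); rewrite -compDr !add0r. Qed.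

Lemma compNl (X Y Z : C) (g : hom Y Z) (f : hom X Y) : (- g) \oc f = - (g \oc f).
Proof. by apply: (addIr (g \oc f)); rewrite -compDl !addNr comp0l. Qed.

Lemma compNr (X Y Z : C) (g : hom Y Z) (f : hom X Y) : g \oc (- f) = - (g \oc f).
Proof. by apply: (addIr (g \oc f)); rewrite -compDr !addNr comp0r. Qed.

Lemma compBl (X Y Z : C) (g g' : hom Y Z) (f : hom X Y) :
  (g - g') \oc f = g \oc f - g' \oc f.
Proof. by rewrite compDl compNl. Qed.

Lemma compBr (X Y Z : C) (g : hom Y Z) (f f' : hom X Y) :
  g \oc (f - f') = g \oc f - g \oc f'.
Proof. by rewrite compDr compNr. Qed.

Lemma zero_id0 (X : C) : id_ X = 0 -> is_zero X.
Proof.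
move=> e; split=> Y f; first by rewrite -[f]comp1r e comp0r.
by rewrite -[f]comp1l e comp0l.
Qed.

Lemma inj_surj_bijective (A B : Type) (f : A -> B) :
  injective f -> (forall b, exists a, f a = b) -> bijective f.
Proof.
move=> fI fS; pose g b := sval (cid (fS b)).
have gK b : f (g b) = b by rewrite /g; case: cid.
by exists g => [a|b] //; apply: fI; rewrite gK.
Qed.

(** Universal arrows chosen object by object assemble into a functor, because uniqueness of
    factorizations forces identities and composites to be respected. *)
Lemma reflections_has_left_adjoint (P : set C) :
  (forall X : C, exists (R : C) (e : hom X R), P R /\
     forall Y, P Y -> forall f : hom X Y, exists! g : hom R Y, g \oc e = f) ->
  has_left_adjoint (full_incl P).
Proof.
move=> refl.
(* Object and arrow are packed into one sigma type, so that a single choice delivers both. *)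
have fam : forall X, exists R : {R : C & hom X R}, P (tag R) /\
     forall Y, P Y -> forall f : hom X Y,
       exists! g : hom (tag R) Y, g \oc tagged R = f.
  by move=> X; have [R [e h]] := refl X; exists (Tagged (fun R => hom X R) e).
pose F X := sval (cid (fam X)); pose hF X := svalP (cid (fam X)).
pose R X := tag (F X); pose e X : hom X (R X) := tagged (F X).
have uniR X Y : P Y -> forall f : hom X Y, exists! g : hom (R X) Y, g \oc e X = f.
  exact: (hF X).2.
have RI X Y (g g' : hom (R X) Y) : P Y -> g \oc e X = g' \oc e X -> g = g'.
  move=> PY h; have [k [_ ku]] := uniR X Y PY (g' \oc e X).
  by rewrite -(ku g h) -(ku g' erefl).
have RP X : P (R X) := (hF X).1.
pose m X Y (f : hom X Y) := sval (cid (uniR X (R Y) (RP Y) (e Y \oc f))).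
have mE X Y (f : hom X Y) : m X Y f \oc e X = e Y \oc f.
  by rewrite /m; case: cid => g [].
have m1 X : m X X (id_ X) = id_ (R X).
  by apply: RI => //; rewrite mE comp1r comp1l.
have mM X Y Z (g : hom Y Z) (f : hom X Y) : m X Z (g \oc f) = m Y Z g \oc m X Y f.
  by apply: RI => //; rewrite mE -compA mE !compA mE.
exists (@Functor C (full_sub P) (fun X => exist _ (R X) (RP X)) m m1 mM).
exists (fun X (Y : full_sub P) (f : hom (R X) (sval Y)) => f \oc e X); split.
- move=> X [Y PY]; apply: inj_surj_bijective; first by move=> g g'; exact: RI.
  by move=> f; have [g [gE _]] := uniR X Y PY f; exists g.
- by move=> X X' Y u f /=; rewrite -!compA mE.
- by move=> X Y Y' v f /=; rewrite -compA.
Qed.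

Lemma coreflections_has_right_adjoint (P : set C) :
  (forall Y : C, exists (R : C) (e : hom R Y), P R /\
     forall X, P X -> forall f : hom X Y, exists! g : hom X R, e \oc g = f) ->
  has_right_adjoint (full_incl P).
Proof.
move=> corefl.
have fam : forall Y, exists R : {R : C & hom R Y}, P (tag R) /\
     forall X, P X -> forall f : hom X Y,
       exists! g : hom X (tag R), tagged R \oc g = f.
  by move=> Y; have [R [e h]] := corefl Y; exists (Tagged (fun R => hom R Y) e).
pose F X := sval (cid (fam X)); pose hF X := svalP (cid (fam X)).
pose R Y := tag (F Y); pose e Y : hom (R Y) Y := tagged (F Y).
have uniR X Y : P X -> forall f : hom X Y, exists! g : hom X (R Y), e Y \oc g = f.
  exact: (hF Y).2.
have RI X Y (g g' : hom X (R Y)) : P X -> e Y \oc g = e Y \oc g' -> g = g'.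
  move=> PX h; have [k [_ ku]] := uniR X Y PX (e Y \oc g').
  by rewrite -(ku g h) -(ku g' erefl).
have RP Y : P (R Y) := (hF Y).1.
(* [adjoint] wants the map from [hom X Y] to [hom X (R Y)], the inverse of composition with the
   counit [e Y]; hence one more choice. *)
pose phi X Y (PX : P X) (f : hom X Y) := sval (cid (uniR X Y PX f)).
have phiE X Y PX f : e Y \oc phi X Y PX f = f by rewrite /phi; case: cid => g [].
pose m X Y (f : hom X Y) := phi (R X) Y (RP X) (f \oc e X).
have mE X Y (f : hom X Y) : e Y \oc m X Y f = f \oc e X by exact: phiE.
have m1 X : m X X (id_ X) = id_ (R X).
  by apply: RI => //; rewrite mE comp1r comp1l.
have mM X Y Z (g : hom Y Z) (f : hom X Y) : m X Z (g \oc f) = m Y Z g \oc m X Y f.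
  by apply: RI => //; rewrite mE compA mE -!compA mE.
exists (@Functor C (full_sub P) (fun X => exist _ (R X) (RP X)) m m1 mM).
exists (fun (X : full_sub P) Y (f : hom (sval X) Y) => phi (sval X) Y (svalP X) f).
split.
- move=> X Y; exists (fun g => e Y \oc g) => [f|g]; first exact: phiE.
  by apply: RI; [exact: svalP X | rewrite phiE].
- move=> X X' Y u f /=; apply: RI; first exact: svalP X'.
  by rewrite phiE compA phiE.
- move=> X Y Y' v f /=; apply: RI; first exact: svalP X.
  by rewrite phiE compA mE -compA phiE.
Qed.

(** The reflection is the unit, the image of an identity under the adjunction; by naturality the
    adjunction is then precomposition with it. *)
Lemma has_left_adjoint_reflections (P : set C) :
  has_left_adjoint (full_incl P) ->
  forall X : C, exists (R : C) (e : hom X R), P R /\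
     forall Y, P Y -> forall f : hom X Y, exists! g : hom R Y, g \oc e = f.
Proof.
move=> [F [phi [phiB phiL phiR]]] X.
exists (sval (F X)), (phi X (F X) (id_ (F X))); split; first exact: svalP (F X).
move=> Y PY f; have [psi phiK psiK] := phiB X (exist _ Y PY).
have phiE (g : hom (sval (F X)) Y) :
    phi X (exist _ Y PY) g = g \oc phi X (F X) (id_ (F X)).
  have := phiR X (F X) (exist _ Y PY) g (id_ (F X)).
  by rewrite /= comp1r.
exists (psi f); split; first by rewrite -phiE psiK.
by move=> g <-; rewrite -phiE phiK.
Qed.

Lemma has_right_adjoint_coreflections (P : set C) :
  has_right_adjoint (full_incl P) ->
  forall Y : C, exists (R : C) (e : hom R Y), P R /\
     forall X, P X -> forall f : hom X Y, exists! g : hom X R, e \oc g = f.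
Proof.
move=> [G [phi [phiB phiL phiR]]] Y.
have [eY _ eYK] := phiB (G Y) Y.
exists (sval (G Y)), (eY (id_ (G Y))); split; first exact: svalP (G Y).
move=> X PX f; have phiE (g : hom X (sval (G Y))) :
    phi (exist _ X PX) Y (eY (id_ (G Y)) \oc g) = g.
  have := phiL (G Y) (exist _ X PX) Y g (eY (id_ (G Y))).
  by rewrite /= eYK /= comp1l.
exists (phi (exist _ X PX) Y f); split; last by move=> g <-.
by apply: (bij_inj (phiB (exist _ X PX) Y)); rewrite phiE.
Qed.

End Preadditive.

(** * Consequences of the axioms of triangulated categories *)

Section Triangulated.
Import GRing.Theory.
Local Open Scope ring_scope.
Local Open Scope classical_set_scope.
Variable D : triangulated.
Implicit Types (A B X Y Z W : D) (P Q N : set D).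

Lemma shift0 X Y : fmap shift (0 : hom X Y) = 0.
Proof.
by apply: (addIr (fmap shift (0 : hom X Y))); rewrite -shiftD !add0r.
Qed.

Lemma shiftN X Y (f : hom X Y) : fmap shift (- f) = - fmap shift f.
Proof. by apply: (addIr (fmap shift f)); rewrite -shiftD !addNr shift0. Qed.

Lemma shift_inj X Y : injective (fun f : hom X Y => fmap shift f).
Proof. exact: bij_inj ((shift_equiv D).1 X Y). Qed.

Lemma shift_surj X Y (g : hom (shift X) (shift Y)) :
  exists f : hom X Y, fmap shift f = g.
Proof. by have [k _ kK] := (shift_equiv D).1 X Y; exists (k g). Qed.

Lemma shift_zero X : is_zero X -> is_zero (shift X).
Proof. by move=> [zX _]; apply: zero_id0; rewrite -fmap1 (zX X (id_ X)) shift0. Qed.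

Lemma desuspension X : exists Y (f : hom (shift Y) X), is_iso f.
Proof. exact: (shift_equiv D).2. Qed.

Section Triangle.
Variables (X Y Z : D) (f : hom X Y) (g : hom Y Z) (h : hom Z (shift X)).
Hypothesis fgh : dist f g h.

Lemma dist_comp0 : g \oc f = 0.
Proof.
have [[O zO] _] := tcat_additive D.
have [c [cE _]] := dist_fill (a := id_ X) (b := f) (dist_id X zO) fgh erefl.
by rewrite -cE comp0r.
Qed.

(** Exactness of Hom(W, -). The rotated triangle W -> 0 -> shift W maps to the rotation of the given
    one; the third component desuspends because the shift is full. *)
Lemma dist_lift W (a : hom W Y) : g \oc a = 0 -> exists b : hom W X, a = f \oc b.
Proof.
move=> ga0; have [[O zO] _] := tcat_additive D.
have WO := (dist_rot _ _ _).1 (dist_id W zO).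
have [|c [_ cE]] := dist_fill (a := a) (b := 0) WO ((dist_rot _ _ _).1 fgh).
  by rewrite ga0 comp0l.
have [b bE] := shift_surj c; exists b; apply: shift_inj.
by move: cE; rewrite fmap1 compNr comp1r compNl fmapM bE => /oppr_inj.
Qed.

Lemma dist_extend W (a : hom Y W) : a \oc f = 0 -> exists b : hom Z W, a = b \oc g.
Proof.
move=> af0; have [[O zO] _] := tcat_additive D.
have OW : dist (0 : hom O W) (id_ W) (0 : hom W (shift O)).
  by apply/dist_rot; rewrite shift0 oppr0; exact/dist_id/shift_zero.
have [|c [cE _]] := dist_fill (a := 0) (b := a) fgh OW; first by rewrite comp0l.
by exists c; rewrite cE comp1l.
Qed.

End Triangle.

(** The cone of [g] is only isomorphic to a shift, so it is replaced along [desuspension]; the sign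
    in [- k] cancels the one introduced by rotation. *)
Lemma dist_fiber Y Z (g : hom Y Z) : exists X (f : hom X Y) (h : hom Z (shift X)), dist f g h.
Proof.
have [X' [h' [f' gh'f']]] := dist_cone g.
have [X [w [w' [w'w ww']]]] := desuspension X'.
have [k kE] := shift_surj (f' \oc w).
exists X, (- k), (w' \oc h'); apply/dist_rot; rewrite shiftN opprK kE.
apply: (dist_iso (a := id_ Y) (b := id_ Z) (c := w')) gh'f'.
- by exists (id_ Y); rewrite !comp1l.
- by exists (id_ Z); rewrite !comp1l.
- by exists w.
- by rewrite comp1l comp1r.
- by rewrite comp1r.
- by rewrite fmap1 comp1l -compA ww' comp1r.
Qed.

(** * Orthogonal subcategories and two-out-of-three in triangles *)

Lemma orthr_triangulated P : triangulated_sub P -> triangulated_sub (orthr P).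
Proof.
move=> [P0 Piso Psh Pcone].
have sh X : orthr P (shift X) <-> orthr P X.
  split=> PX V PV f.
    by apply: shift_inj; rewrite shift0; apply: PX; exact: (Psh V).2 PV.
  (* The test object [V] must be a shift before fullness of the shift applies; it is one up to
     isomorphism, and [P] is closed under isomorphism. *)
  have [V' [w [w' [w'w ww']]]] := desuspension V.
  have PV' : P V' by apply/(Psh V'); apply: (Piso _ _ w' _ PV); exists w.
  have [k kE] := shift_surj (f \oc w).
  by rewrite -[f]comp1r -ww' compA -kE (PX _ PV' k) shift0 comp0l.
split=> //.
- by move=> X [_ zX] V _ f; exact: zX.
- move=> X Y f [f' [_ ff']] PX V PV g.
  by rewrite -[g]comp1l -ff' -compA (PX V PV (f' \oc g)) comp0r.
- move=> X Y Z f g h fgh PX PY V PV a.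
  have [|b ->] := dist_lift ((dist_rot _ _ _).1 fgh) (a := a).
    exact: ((sh X).2 PX).
  by rewrite (PY _ PV b) comp0r.
Qed.

Lemma orthl_triangulated P : triangulated_sub P -> triangulated_sub (orthl P).
Proof.
move=> [P0 Piso Psh Pcone].
have sh X : orthl P (shift X) <-> orthl P X.
  split=> PX V PV f.
    by apply: shift_inj; rewrite shift0; apply: PX; exact: (Psh V).2 PV.
  have [V' [w [w' [w'w ww']]]] := desuspension V.
  have PV' : P V' by apply/(Psh V'); apply: (Piso _ _ w' _ PV); exists w.
  have [k kE] := shift_surj (w' \oc f).
  by rewrite -[f]comp1l -ww' -compA -kE (PX _ PV' k) shift0 comp0r.
split=> //.
- by move=> X [zX _] V _ f; exact: zX.
- move=> X Y f [f' [_ ff']] PX V PV g.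
  by rewrite -[g]comp1r -ff' compA (PX V PV (g \oc f)) comp0l.
- move=> X Y Z f g h fgh PX PY V PV a.
  have [|b ->] := dist_extend ((dist_rot _ _ _).1 fgh) (a := a).
    exact: PY.
  by rewrite ((sh X).2 PX _ PV b) comp0l.
Qed.

Lemma triangulated_sub_dist12 P X Y Z (f : hom X Y) (g : hom Y Z)
    (h : hom Z (shift X)) : triangulated_sub P -> dist f g h -> P X -> P Y -> P Z.
Proof. by move=> [_ _ _]; exact. Qed.

Lemma triangulated_sub_dist23 P X Y Z (f : hom X Y) (g : hom Y Z)
    (h : hom Z (shift X)) : triangulated_sub P -> dist f g h -> P Y -> P Z -> P X.
Proof. by move=> [_ _ sh cone] /dist_rot fgh PY PZ; exact/sh/(cone _ _ _ _ _ _ fgh). Qed.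

Lemma triangulated_sub_dist13 P X Y Z (f : hom X Y) (g : hom Y Z)
    (h : hom Z (shift X)) : triangulated_sub P -> dist f g h -> P X -> P Z -> P Y.
Proof.
move=> tP /dist_rot fgh PX PZ; have [_ _ sh _] := tP.
by apply: (triangulated_sub_dist23 tP fgh PZ); exact/sh.
Qed.

(** By the octahedral axiom the cone of the composite is an extension of the two given cones. *)
Lemma cone_in_comp N X Y Z (f : hom X Y) (g : hom Y Z) :
  triangulated_sub N -> cone_in N f -> cone_in N g -> cone_in N (g \oc f).
Proof.
move=> tN [Z' [f1 [f2 [df NZ']]]] [X' [g1 [g2 [dg NX']]]].
have [Y' [h1 [h2 dgf]]] := dist_cone (g \oc f).
have [u [v [duv _ _ _ _]]] := dist_octahedron df dg dgf.
by exists Y', h1, h2; split=> //; exact: (triangulated_sub_dist13 tN duv).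
Qed.

(** * Semiorthogonal decompositions and admissible subcategories *)

Definition semiorthogonal P Q : Prop :=
  [/\ triangulated_sub P, triangulated_sub Q,
      forall X Y, P X -> Q Y -> forall f : hom X Y, f = 0
    & forall X, exists A B (a : hom A X) (b : hom X B) (c : hom B (shift A)),
        [/\ dist a b c, P A & Q B]].

Lemma semiorthogonal_zero P Q X : semiorthogonal P Q -> P X -> Q X -> is_zero X.
Proof. by move=> [_ _ PQ0 _] PX QX; apply: zero_id0; exact: PQ0. Qed.

(** If X is right orthogonal to [P], the map A -> X in its triangle is zero, so the identity of
    [shift A] factors through B. Such a factorization vanishes, hence A = 0 and X inherits
    membership from B. *)
Lemma semiorthogonal_orthr P Q : semiorthogonal P Q -> Q = orthr P.
Proof.
move=> sPQ; have [tP tQ PQ0 dec] := sPQ; apply/seteqP; split=> X.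
  by move=> QX Y PY f; exact: PQ0.
move=> PX; have [A [B [a [b [c [abc PA QB]]]]]] := dec X.
have [tP0 _ shP _] := tP; have [tQ0 _ shQ _] := tQ.
apply: (triangulated_sub_dist13 tQ abc) => //; apply/shQ/tQ0/zero_id0.
have [|u ->] := dist_lift ((dist_rot _ _ _).1 ((dist_rot _ _ _).1 abc)) (a := id_ (shift A)).
  by rewrite (PX _ PA a) shift0 oppr0 comp0l.
by rewrite (PQ0 _ _ ((shP A).2 PA) QB u) comp0r.
Qed.

Lemma semiorthogonal_orthl P Q : semiorthogonal P Q -> P = orthl Q.
Proof.
move=> sPQ; have [tP tQ PQ0 dec] := sPQ; apply/seteqP; split=> X.
  by move=> PX Y QY f; exact: PQ0.
move=> QX; have [A [B [a [b [c [abc PA QB]]]]]] := dec X.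
have [tP0 _ shP _] := tP.
apply: (triangulated_sub_dist13 tP abc) => //; apply/tP0/zero_id0.
have [|u ->] := dist_extend ((dist_rot _ _ _).1 abc) (a := id_ B).
  by rewrite (QX _ QB b) comp0r.
by rewrite (PQ0 _ _ ((shP A).2 PA) QB u) comp0l.
Qed.

(** The map X -> B is the reflection: two factorizations differ by a map through [shift A], which is
    zero. *)
Lemma semiorthogonal_left_admissible P Q : semiorthogonal P Q -> left_admissible Q.
Proof.
move=> [tP tQ PQ0 dec]; split=> //; apply: reflections_has_left_adjoint => X.
have [A [B [a [b [c [abc PA QB]]]]]] := dec X.
exists B, b; split=> // Y QY f.
have [|g ->] := dist_extend abc (a := f); first exact: PQ0.
exists g; split=> // g' gE; apply/eqP; rewrite -subr_eq0; apply/eqP.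
have [|k ->] := dist_extend ((dist_rot _ _ _).1 abc) (a := g - g').
  by rewrite compBl gE subrr.
have [_ _ shP _] := tP.
by rewrite (PQ0 _ _ ((shP A).2 PA) QY k) comp0l.
Qed.

Lemma semiorthogonal_right_admissible P Q : semiorthogonal P Q -> right_admissible P.
Proof.
move=> [tP tQ PQ0 dec]; split=> //; apply: coreflections_has_right_adjoint => Y.
have [A [B [a [b [c [abc PA QB]]]]]] := dec Y.
exists A, a; split=> // X PX f.
have [|g ->] := dist_lift abc (a := f); first exact: PQ0.
exists g; split=> // g' gE; apply/eqP; rewrite -subr_eq0; apply/eqP.
apply: shift_inj; rewrite shift0.
have [|k ->] := dist_lift ((dist_rot _ _ _).1 ((dist_rot _ _ _).1 abc))
                          (a := fmap shift (g - g')).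
  by rewrite compNl -fmapM compBr gE subrr shift0 oppr0.
have [_ _ shP _] := tP.
by rewrite (PQ0 _ _ ((shP X).2 PX) QB k) comp0r.
Qed.

(** The triangle is the cone of the coreflection A -> X. A map from [P] to the cone B dies in
    [shift A] by uniqueness of factorizations, so it lifts to X, then to A, and A -> X -> B is
    zero. *)
Lemma right_admissible_semiorthogonal P :
  right_admissible P -> semiorthogonal P (orthr P).
Proof.
move=> [tP /has_right_adjoint_coreflections corefl]; have [_ Piso shP _] := tP.
split=> //; first exact: orthr_triangulated.
  by move=> X Y PX PY f; exact: PY.
move=> X; have [A [a [PA univ]]] := corefl X.
have [B [b [c abc]]] := dist_cone a.
exists A, B, a, b, c; split=> // V PV f.
have aI W (g : hom W A) : P W -> a \oc g = 0 -> g = 0.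
  move=> PW ag; have [k [_ ku]] := univ W PW 0.
  by rewrite -(ku g ag) -(ku 0 (comp0r _ _)).
have [V' [w [w' [w'w ww']]]] := desuspension V.
have PV' : P V' by apply/(shP V'); apply: (Piso _ _ w' _ PV); exists w.
have ca : fmap shift a \oc c = 0.
  have := dist_comp0 ((dist_rot _ _ _).1 ((dist_rot _ _ _).1 abc)).
  by rewrite compNl => /eqP; rewrite oppr_eq0 => /eqP.
have cf0 : c \oc f = 0.
  have [k kE] := shift_surj (c \oc f \oc w).
  have k0 : k = 0.
    by apply: aI => //; apply: shift_inj; rewrite fmapM kE compA ca comp0l shift0.
  by rewrite -[c \oc f]comp1r -ww' compA -[(c \oc f) \oc w]compA -kE k0 shift0 comp0l.
have [g ->] := dist_lift ((dist_rot _ _ _).1 abc) cf0.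
have [k [<- _]] := univ V PV g.
by rewrite compA (dist_comp0 abc) comp0l.
Qed.

Lemma left_admissible_semiorthogonal Q :
  left_admissible Q -> semiorthogonal (orthl Q) Q.
Proof.
move=> [tQ /has_left_adjoint_reflections refl]; have [_ Qiso shQ _] := tQ.
split=> //; first exact: orthl_triangulated.
  by move=> X Y PX PY f; exact: PX.
move=> X; have [B [b [QB univ]]] := refl X.
have bI W (g : hom B W) : Q W -> g \oc b = 0 -> g = 0.
  move=> QW gb; have [k [_ ku]] := univ W QW 0.
  by rewrite -(ku g gb) -(ku 0 (comp0l _ _)).
have [A [a [c abc]]] := dist_fiber b.
exists A, B, a, b, c; split=> // V QV f.
have [|m mE] := dist_extend ((dist_rot _ _ _).1 ((dist_rot _ _ _).1 abc))
                            (a := fmap shift f).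
  apply: bI; first exact: (shQ V).2 QV.
  by rewrite -compA (dist_comp0 ((dist_rot _ _ _).1 abc)) comp0r.
have [n nE] := shift_surj m; apply: shift_inj.
have [l [lE _]] := univ V QV n.
by rewrite mE -nE -shiftN -fmapM -lE compNr -compA (dist_comp0 abc) comp0r oppr0.
Qed.

(** If f dies in the quotient, it factors through an object of [N], and orthogonality on either side
    kills one of the two factors. *)
Lemma verdier_hom0_eq0 (T N : set D) X Y (f : hom X Y) :
  triangulated_sub N -> T X -> verdier_hom0 T N X Y ->
  orthl N X \/ orthr N Y -> f = 0.
Proof.
move=> [N0 _ _ _] TX h0 NXY.
have [|W [u [u' [_ [Z [g [h [ug NZ]]]] _ /= fu0]]]] := h0 (roof_of f).
  split=> //; have [[O zO] _] := tcat_additive D.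
  (* The cone of an identity is zero, so [roof_of f] is a legitimate roof. *)
  by exists O, 0, 0; split; [exact: dist_id | exact: N0].
move: ug fu0; rewrite comp1l comp0l => ug fu0.
have [k ->] := dist_extend ug fu0.
by case: NXY => [NX|NY]; [rewrite (NX _ NZ g) comp0r | rewrite (NY _ NZ k) comp0l].
Qed.

End Triangulated.

(** * Strictness for a lattice of semiorthogonal decompositions *)

Section SemiorthogonalFamily.
Import Order.TTheory GRing.Theory.
Local Open Scope order_scope.
Local Open Scope ring_scope.
Local Open Scope classical_set_scope.
Variables (D : triangulated) (d : Order.disp_t) (L : latticeType d).
Variables P Q : L -> set D.
Hypothesis PQ : forall I, semiorthogonal (P I) (Q I).
Hypothesis P_meet : forall I J, P (Order.meet I J) = P I `&` P J.
Hypothesis Q_join : forall I J, Q (Order.join I J) = Q I `&` Q J.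
Implicit Types (I J : L) (X Y Z W : D).

Let P_tri I : triangulated_sub (P I). Proof. by case: (PQ I). Qed.
Let Q_tri I : triangulated_sub (Q I). Proof. by case: (PQ I). Qed.

Let hom0 I X Y (f : hom X Y) : P I X -> Q I Y -> f = 0.
Proof. by move=> PX QY; have [_ _ h _] := PQ I; exact: h. Qed.

Lemma P_joinl I J X : P I X -> P (Order.join I J) X.
Proof.
move=> PX; rewrite (semiorthogonal_orthl (PQ _)) => Y.
by rewrite Q_join => -[QY _] f; exact: hom0 PX QY.
Qed.
Arguments P_joinl {I J X}.

Lemma Q_meetl I J Y : Q I Y -> Q (Order.meet I J) Y.
Proof.
move=> QY; rewrite (semiorthogonal_orthr (PQ _)) => X.
by rewrite P_meet => -[PX _] f; exact: hom0 PX QY.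
Qed.
Arguments Q_meetl {I J Y}.

Lemma P_meetl I J X : P (Order.meet I J) X -> P I X.
Proof. by rewrite P_meet => -[]. Qed.
Arguments P_meetl {I J X}.

Lemma Q_joinl I J X : Q (Order.join I J) X -> Q I X.
Proof. by rewrite Q_join => -[]. Qed.
Arguments Q_joinl {I J X}.

Definition P_strict : Prop := forall I J X Y, P I X -> P J Y ->
  verdier_hom0 (P (Order.join I J)) (P (Order.meet I J)) X Y.

(** [Q] reverses the order, so the meet indexes the ambient category and the join the one divided
    out. *)
Definition Q_strict : Prop := forall I J X Y, Q I X -> Q J Y ->
  verdier_hom0 (Q (Order.meet I J)) (Q (Order.join I J)) X Y.

(** The intersection of [P I] with [Q (Order.meet I J)] is a copy inside D of the Verdier quotient
    of [P I] by [P (Order.meet I J)]. *)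
Definition P_orthogonal : Prop := forall I J X Y,
  P I X -> Q (Order.meet I J) X -> P J Y -> Q (Order.meet I J) Y ->
  forall f : hom X Y, f = 0.

Definition Q_orthogonal : Prop := forall I J X Y,
  Q I X -> P (Order.join I J) X -> Q J Y -> P (Order.join I J) Y ->
  forall f : hom X Y, f = 0.

Lemma P_strict_orthogonal : P_strict -> P_orthogonal.
Proof.
move=> str I J X Y PX QX PY QY f.
apply: (verdier_hom0_eq0 f (P_tri _) (P_joinl PX) (str I J X Y PX PY)).
by right=> V PV g; exact: hom0 PV QY.
Qed.

Lemma Q_strict_orthogonal : Q_strict -> Q_orthogonal.
Proof.
move=> str I J X Y QX PX QY PY f.
apply: (verdier_hom0_eq0 f (Q_tri _) (Q_meetl QX) (str I J X Y QX QY)).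
by left=> V QV g; exact: hom0 PX QV.
Qed.

(** The apex of a roof may be replaced by its component W in [P (Order.join I J)]. The numerator
    then factors through the same component of Y, where orthogonality makes it zero. *)
Lemma Q_orthogonal_strict : Q_orthogonal -> Q_strict.
Proof.
move=> orth I J X Y QX QY [Z s f] [/= QZ cs].
have [_ _ _ dec] := PQ (Order.join I J).
have [W [Z'' [u [v [w [uvw PW QZ'']]]]]] := dec Z.
have [Y' [Y'' [a [b [c [abc PY' QY'']]]]]] := dec Y.
have csu : cone_in (Q (Order.join I J)) (s \oc u).
  by apply: cone_in_comp => //; exists Z'', v, w.
have QW : Q I W.
  have [B [g [h [sgh /Q_joinl QB]]]] := csu.
  exact: (triangulated_sub_dist23 _ sgh QX QB).
have QY'J : Q J Y'.
  apply: (triangulated_sub_dist23 _ abc QY _) => //.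
  by move: QY''; rewrite joinC; exact: Q_joinl.
exists W, u, (s \oc u); split=> //=; last 2 first.
- by rewrite comp1l.
- have [|k ->] := dist_lift abc (a := f \oc u); first exact: hom0 PW QY''.
  by rewrite (orth I J W Y' QW PW QY'J PY' k) comp0r comp0l.
apply: (triangulated_sub_dist23 _ uvw QZ _) => //.
exact/Q_meetl/Q_joinl/QZ''.
Qed.

Lemma P_orthogonal_strict : P_orthogonal -> P_strict.
Proof.
move=> orth I J X Y PX PY [Z s f] [/= PZ cs].
have [_ _ _ dec] := PQ (Order.meet I J).
have [Z' [Z'' [u [v [w [uvw PZ' QZ'']]]]]] := dec Z.
have [Y' [Y'' [a [b [c [abc PY' QY'']]]]]] := dec Y.
have PZI : P I Z.
  have [B [g [h [sgh /P_meetl PB]]]] := cs.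
  exact: (triangulated_sub_dist23 _ sgh PX PB).
have PZ''I : P I Z'' by apply: (triangulated_sub_dist12 _ uvw (P_meetl PZ') PZI).
have PY''J : P J Y''.
  apply: (triangulated_sub_dist12 _ abc _ PY) => //.
  by move: PY'; rewrite meetC; exact: P_meetl.
(* Orthogonality pushes f into [Y'], an object of [P (Order.meet I J)]; the fiber of Z -> [Y'] is
   then an apex on which f vanishes. *)
have bf0 : b \oc f = 0.
  have [|k ->] := dist_extend uvw (a := b \oc f); first exact: hom0 PZ' QY''.
  by rewrite (orth I J Z'' Y'' PZ''I QZ'' PY''J QY'' k) comp0l.
have [f' fE] := dist_lift abc bf0.
have [W [t [r tf'r]]] := dist_fiber f'.
exists W, t, (s \oc t); split=> /=.
- apply: (triangulated_sub_dist23 _ tf'r PZ _) => //.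
  exact/P_joinl/P_meetl/PY'.
- by apply: cone_in_comp => //; exists Y', f', r.
- by rewrite comp1l.
- by rewrite fE -compA (dist_comp0 tf'r) comp0r comp0l.
Qed.

Lemma P_orthogonal_Q_orthogonal : P_orthogonal -> Q_orthogonal.
Proof.
move=> orth.
(* Split X as A -> X -> B along J. Orthogonality puts A in [Q I], hence B too; then B lies in both
   halves of the decomposition at the join, so B = 0. *)
have key I J X : Q I X -> P (Order.join I J) X -> P J X.
  move=> QX PX; have [_ _ _ dec] := PQ J.
  have [A [B [a [b [c [abc PA QB]]]]]] := dec X.
  have QMJ : Q J `<=` Q (Order.meet I J) by move=> V QV; rewrite meetC; exact: Q_meetl.
  have QMA : Q (Order.meet I J) A.
    by apply: (triangulated_sub_dist23 _ abc (Q_meetl QX) (QMJ _ QB)).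
  have QIA : Q I A.
    rewrite (semiorthogonal_orthr (PQ I)) => Z PZ f.
    have [_ _ _ decM] := PQ (Order.meet I J).
    have [Z' [Z'' [u [v [w [uvw PZ' QZ'']]]]]] := decM Z.
    have PZ'' : P I Z'' by apply: (triangulated_sub_dist12 _ uvw (P_meetl PZ') PZ).
    have [|k ->] := dist_extend uvw (a := f); first exact: hom0 PZ' QMA.
    by rewrite (orth I J Z'' A PZ'' QZ'' PA QMA k) comp0l.
  have QIB : Q I B by apply: (triangulated_sub_dist12 _ abc QIA QX).
  have PUB : P (Order.join I J) B.
    apply: (triangulated_sub_dist12 _ abc _ PX) => //.
    by rewrite joinC; exact: P_joinl.
  have [P0 _ _ _] := P_tri J.
  apply: (triangulated_sub_dist13 _ abc PA _) => //.
  by apply/P0/(semiorthogonal_zero (PQ _) PUB); rewrite Q_join.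
move=> I J X Y QX PX QY PY f.
rewrite joinC in PY.
apply: (orth J I).
- exact: key QX PX.
- by rewrite meetC; exact: Q_meetl.
- exact: key QY PY.
- exact: Q_meetl.
Qed.

Lemma Q_orthogonal_P_orthogonal : Q_orthogonal -> P_orthogonal.
Proof.
move=> orth.
(* Dually, B lands in [P I], so A lies in both halves of the decomposition at the meet and
   vanishes. *)
have key I J X : P I X -> Q (Order.meet I J) X -> Q J X.
  move=> PX QX; have [_ _ _ dec] := PQ J.
  have [A [B [a [b [c [abc PA QB]]]]]] := dec X.
  have PUJ : P J `<=` P (Order.join I J) by move=> V PV; rewrite joinC; exact: P_joinl.
  have PUB : P (Order.join I J) B.
    by apply: (triangulated_sub_dist12 _ abc (PUJ _ PA) (P_joinl PX)).
  have PIB : P I B.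
    rewrite (semiorthogonal_orthl (PQ I)) => Z QZ f.
    have [_ _ _ decU] := PQ (Order.join I J).
    have [Z' [Z'' [u [v [w [uvw PZ' QZ'']]]]]] := decU Z.
    have QZ' : Q I Z' by apply: (triangulated_sub_dist23 _ uvw QZ (Q_joinl QZ'')).
    have [|k ->] := dist_lift uvw (a := f); first exact: hom0 PUB QZ''.
    rewrite joinC in PUB PZ'.
    by rewrite (orth J I B Z' QB PUB QZ' PZ' k) comp0r.
  have PIA : P I A by apply: (triangulated_sub_dist23 _ abc PX PIB).
  have QMA : Q (Order.meet I J) A.
    apply: (triangulated_sub_dist23 _ abc QX _) => //.
    by rewrite meetC; exact: Q_meetl.
  have [Q0 _ _ _] := Q_tri J.
  apply: (triangulated_sub_dist13 _ abc _ QB) => //.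
  by apply/Q0/(semiorthogonal_zero (PQ (Order.meet I J))) => //; rewrite P_meet.
move=> I J X Y PX QX PY QY f.
rewrite meetC in QY.
apply: (orth J I).
- exact: key PX QX.
- by rewrite joinC; exact: P_joinl.
- exact: key PY QY.
- exact: P_joinl.
Qed.

Lemma P_strict_Q_strict : P_strict <-> Q_strict.
Proof.
split=> [/P_strict_orthogonal|/Q_strict_orthogonal].
  by move=> /P_orthogonal_Q_orthogonal/Q_orthogonal_strict.
by move=> /Q_orthogonal_P_orthogonal/P_orthogonal_strict.
Qed.

End SemiorthogonalFamily.

(** * Orthogonals of the zero subcategory and of the whole category *)

Section Zero.
Variable D : triangulated.

Lemma orthr_setT : orthr setT = [set X : D | is_zero X]%classic.
Proof.
apply/seteqP; split=> X; last by move=> [_ zX] Y _ f; exact: (zX Y f).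
by move=> oX; exact: zero_id0 (oX X I _).
Qed.

Lemma orthl_setT : orthl setT = [set X : D | is_zero X]%classic.
Proof.
apply/seteqP; split=> X; last by move=> [zX _] Y _ f; exact: (zX Y f).
by move=> oX; exact: zero_id0 (oX X I _).
Qed.

Lemma orthr_zero : orthr [set X : D | is_zero X]%classic = setT.
Proof. by apply/seteqP; split=> // Y _ X [zX _] f; exact: (zX Y f). Qed.

Lemma orthl_zero : orthl [set X : D | is_zero X]%classic = setT.
Proof. by apply/seteqP; split=> // Y _ X [_ zX] f; exact: (zX Y f). Qed.

End Zero.

Theorem proposition1p5 :
  forall (d : Order.disp_t) (L : finTBLatticeType d) (D : triangulated)
    (F : L -> set D),
  (right_admissible_filtration F ->
     left_admissible_filtration (L := L^d) (fun I : L^d => orthr (F I)) /\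
     (strict_filtration F ->
        strict_filtration (L := L^d) (fun I : L^d => orthr (F I)))) /\
  (left_admissible_filtration F ->
     right_admissible_filtration (L := L^d) (fun I : L^d => orthl (F I)) /\
     (strict_filtration F ->
        strict_filtration (L := L^d) (fun I : L^d => orthl (F I)))).
Proof.
move=> d L D F; split=> -[adm mono [F0 F1] Fmeet Fjoin].
  have so I := right_admissible_semiorthogonal (adm I).
  split; last exact: (P_strict_Q_strict so Fmeet Fjoin).1.
  split.
  - by move=> I; exact: semiorthogonal_left_admissible (so I).
  - by move=> I J IJ Y oY X FX; apply: oY; exact: mono IJ _ FX.
  - by split; [rewrite F1 orthr_setT | rewrite F0 orthr_zero].
  - exact: Fjoin.
  (* Double orthogonals give back [F], and the join of [L^d] is the meet of [L]. *)
  - by move=> I J; rewrite -!(semiorthogonal_orthl (so _)); exact: Fmeet.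
have so I := left_admissible_semiorthogonal (adm I).
split; last first.
  (* Here [F] plays the part of [Q]; it reverses the order of [L^d], so the equivalence is used over
     [L^d], from [Q] to [P]. *)
  exact: (P_strict_Q_strict (L := L^d) so Fjoin Fmeet).2.
split.
- by move=> I; exact: semiorthogonal_right_admissible (so I).
- by move=> I J IJ Y oY X FX; apply: oY; exact: mono IJ _ FX.
- by split; [rewrite F1 orthl_setT | rewrite F0 orthl_zero].
- exact: Fjoin.
- by move=> I J; rewrite -!(semiorthogonal_orthr (so _)); exact: Fmeet.
Qed.
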